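(* Let $n\ge 4$ and $k\ge 1$ be integers. Then \[ \gamma_{[k]R}(C_5\Box P_n)\le 5(n-2)\left\lceil\frac{k+5}{5}\right\rceil+10\left\lceil\frac{k+3-\left\lceil\frac{k+5}{5}\right\rceil}{3}\right\rceil-n\le \frac{3nk+30n+2k-10}{3}. \]
   Context: For a graph $G$ and $v\in V(G)$, $N(v)$ is the open neighborhood and $N[v]=N(v)\cup\{v\}$. For an integer $k\ge1$, a function $f:V(G)\to\{0,1,\dots,k+1\}$ is a $[k]$-Roman dominating function if for every vertex $v$ with $f(v)<k$ we have $\sum_{u\in N[v]}f(u)\ge k+|\{u\in N(v): f(u)>0\}|$. The weight of $f$ is $\sum_{v}f(v)$, and $\gamma_{[k]R}(G)$ is the minimum weight of a $[k]$-Roman dominating function on $G$. $C_m\Box P_n$ is the Cartesian product of the cycle $C_m$ (vertices $0,\dots,m-1$ mod $m$) and the path $P_n$ (vertices $0,\dots,n-1$): $(i,j)\sim(i',j')$ iff ($i=i'$ and $|j-j'|=1$) or ($j=j'$ and $i'\equiv i\pm1 \pmod m$). *)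

(* Defs.v *)
From mathcomp Require Import all_boot.

Set Implicit Arguments.
Unset Strict Implicit.
Unset Printing Implicit Defensive.

(* A finite graph is given by its adjacency relation [e : rel V] on a finite
   type of vertices. *)
Section KRoman.
Variables (V : finType) (e : rel V) (k : nat).

Definition open_nbh (v : V) : {set V} := [set u | e v u].
Definition closed_nbh (v : V) : {set V} := v |: open_nbh v.

(* ['I_k.+2] is the label set {0, 1, ..., k + 1}. *)
Definition is_kRDF (f : {ffun V -> 'I_k.+2}) : bool :=
  [forall v, (f v < k) ==>
    (k + #|[set u in open_nbh v | 0 < f u]| <= \sum_(u in closed_nbh v) f u)].

Definition weight (f : {ffun V -> 'I_k.+2}) : nat := \sum_v f v.

Definition kRDF_top : {ffun V -> 'I_k.+2} := [ffun=> ord_max].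

Lemma is_kRDF_top : is_kRDF kRDF_top.
Proof. by apply/forallP=> v; rewrite ffunE /= ltnNge leqnSn. Qed.

(* [arg min_] needs a feasible starting point; by [is_kRDF_top] the constant
   function k + 1 is one, so the value below is a genuine minimum. *)
Definition gamma_kR : nat :=
  weight [arg min_(f < kRDF_top | is_kRDF f) weight f].

Lemma gamma_kR_attained : exists2 f, is_kRDF f & weight f = gamma_kR.
Proof.
by rewrite /gamma_kR; case: arg_minnP => [|f Pf _];
  [exact: is_kRDF_top | exists f].
Qed.

Lemma gamma_kR_min f : is_kRDF f -> gamma_kR <= weight f.
Proof.
by rewrite /gamma_kR; case: arg_minnP => [|g _ g_min];
  [exact: is_kRDF_top | exact: g_min].
Qed.

End KRoman.

(* For m >= 3 this is the simple cycle on {0, ..., m - 1}. *)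
Definition cycle_adj (m : nat) : rel 'I_m :=
  [rel i i' : 'I_m | (i' == i + 1 %[mod m]) || (i == i' + 1 %[mod m])].

Definition path_adj (n : nat) : rel 'I_n :=
  [rel j j' : 'I_n | (j' == j + 1 :> nat) || (j == j' + 1 :> nat)].

Definition cartesian_adj (V W : finType) (e1 : rel V) (e2 : rel W) :
    rel (V * W) :=
  [rel x y : V * W | (x.1 == y.1) && e2 x.2 y.2 || (x.2 == y.2) && e1 x.1 y.1].

Definition cycle_box_path (m n : nat) : rel ('I_m * 'I_n) :=
  cartesian_adj (@cycle_adj m) (@path_adj n).

Arguments gamma_kR {V} e k.
Arguments cycle_box_path : clear implicits.

(* Main.v *)
(* For each t mod 5 the vertices of C_5 x Z with i - 2j = t form a perfect code:
   every closed neighbourhood contains exactly one of them. If f is positive with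
   f = g + 1 on its support, it suffices that f v plus the values g of the
   neighbours of v add up to k. Labelling the codes t = 0, 1, 2 with g = k/3,
   (k+2)/3, (k+1)/3 (rounded down, with sum k) achieves this on C_5 x Z. Cutting
   the strip at either end removes a codeword from three consecutive vertices of
   the boundary cycle, and a single positive label at the middle one compensates
   for all three. The weight n(k+3) + 2 + [k/3] + [(k+1)/3] is within the bound
   unless n = 4 and k = 5 mod 15, where it is too large by one; there an explicit
   labelling is used. *)

Require Import Defs.
From mathcomp Require Import all_boot all_order all_algebra.
From mathcomp Require Import zify ring lra.
Import Order.TTheory GRing.Theory Num.Theory.
Local Open Scope ring_scope.

(** Each positive neighbour contributes its predecessor plus one; these ones cancel the count of
    positive neighbours, while zero labels contribute 0 on both sides. *)
Lemma is_kRDF_pred (V : finType) (e : rel V) (k : nat)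
    (f : {ffun V -> 'I_k.+2}) :
  irreflexive e ->
  (forall v, (k <= f v + \sum_(u in open_nbh e v) (f u).-1)%N) ->
  is_kRDF e f.
Proof.
move=> irr_e cover; apply/forallP=> v; apply/implyP=> _.
rewrite big_setU1 ?inE ?irr_e //=.
have -> : (\sum_(u in open_nbh e v) f u =
    \sum_(u in open_nbh e v) (f u).-1 +
    #|[set u in open_nbh e v | (0 < f u)%N]|)%N.
  rewrite cardsE -sum1_card big_mkcondr /= -big_split /=.
  by apply: eq_bigr => u _; case: (nat_of_ord (f u)) => //= m; rewrite addn1.
by rewrite addnA leq_add2r.
Qed.

Lemma leq_sum_seq_set (V : finType) (A : {set V}) (s : seq V) (F : V -> nat) :
  uniq s -> {subset s <= A} ->
  (\sum_(u <- s) F u <= \sum_(u in A) F u)%N.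
Proof.
move=> s_uniq sA; rewrite big_uniq //= [leqRHS](bigID (mem s)) /=.
apply: leq_trans (leq_addr _ _); apply: eq_leq; apply: eq_bigl => u.
by rewrite andb_idl //; apply: sA.
Qed.

Lemma cycle_box_path_irr (n : nat) : irreflexive (cycle_box_path 5 n).
Proof.
case=> i j; rewrite /cycle_box_path /cartesian_adj /= !eqxx /=.
by apply/negbTE; case: i => i Hi /=; rewrite !negb_or; lia.
Qed.

Lemma sum_rotate5 (F : nat -> nat) (a : nat) :
  (\sum_(i < 5) F ((i + 3 * a) %% 5) = \sum_(t < 5) F t)%N.
Proof.
have rot i : (inord ((i + 3 * a) %% 5) : 'I_5) = ((i + 3 * a) %% 5)%N :> nat.
  by rewrite inordK // ltn_mod.
have rot_inj : injective (fun i : 'I_5 => inord ((i + 3 * a) %% 5) : 'I_5).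
  move=> i i' /(congr1 val) /=; rewrite !rot => ii'.
  by apply: val_inj => /=; move: (ltn_ord i) (ltn_ord i'); lia.
by rewrite [RHS](reindex_inj rot_inj); apply: eq_bigr => i _; rewrite rot.
Qed.

(* The vertex (i, j) gets the label [L t j] with t = i - 2j = i + 3j mod 5. *)
Lemma gamma_le_table (n k : nat) (L : nat -> nat -> nat) :
  (forall t j, (t < 5)%N -> (j < n)%N -> (L t j <= k.+1)%N) ->
  (forall t j, (t < 5)%N -> (j < n)%N ->
     (k <= L t j + (L ((t + 1) %% 5) j).-1 + (L ((t + 4) %% 5) j).-1
           + (if j.+1 < n then (L ((t + 3) %% 5) j.+1).-1 else 0)
           + (if 0 < j then (L ((t + 2) %% 5) j.-1).-1 else 0))%N) ->
  (gamma_kR (cycle_box_path 5 n) k <= \sum_(j < n) \sum_(t < 5) L t j)%N.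
Proof.
case: n => [|n] L_le cover.
  rewrite big_ord0; have [f _ <-] := gamma_kR_attained (cycle_box_path 5 0) k.
  by rewrite /weight big1 // => -[i [j Hj]].
pose cls (u : 'I_5 * 'I_n.+1) := ((u.1 + 3 * u.2) %% 5)%N.
have cls5 u : (cls u < 5)%N by rewrite ltn_mod.
pose f : {ffun 'I_5 * 'I_n.+1 -> 'I_k.+2} := [ffun u => inord (L (cls u) u.2)].
have fE u : f u = L (cls u) u.2 :> nat.
  by rewrite ffunE inordK // ltnS L_le.
have -> : (\sum_(j < n.+1) \sum_(t < 5) L t j = weight f)%N.
  rewrite /weight (eq_bigr _ (fun u _ => fE u)).
  rewrite -(pair_bigA _ (fun (i : 'I_5) (j : 'I_n.+1) => L ((i + 3 * j) %% 5)%N j)).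
  rewrite exchange_big /=; apply: eq_bigr => j _.
  by rewrite (sum_rotate5 (L^~ j)).
apply: gamma_kR_min; apply: is_kRDF_pred; first exact: cycle_box_path_irr.
case=> i j; have Hi := ltn_ord i; have Hj := ltn_ord j.
(* The neighbours of [(i, j)], whose classes are shifted by 1, 4, 3, 2 in this order; the last two
   exist only away from the ends. *)
pose s := [:: (inord ((i + 1) %% 5) : 'I_5, j); (inord ((i + 4) %% 5), j)]
  ++ (if (j.+1 < n.+1)%N then [:: (i, inord j.+1)] else [::])
  ++ (if (0 < j)%N then [:: (i, inord j.-1 : 'I_n.+1)] else [::]).
have i1 : (inord ((i + 1) %% 5) : 'I_5) = ((i + 1) %% 5)%N :> nat.
  by rewrite inordK // ltn_mod.
have i4 : (inord ((i + 4) %% 5) : 'I_5) = ((i + 4) %% 5)%N :> nat.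
  by rewrite inordK // ltn_mod.
have jS : (j.+1 < n.+1)%N -> (inord j.+1 : 'I_n.+1) = j.+1 :> nat.
  by move=> H; rewrite inordK.
have jP : (0 < j)%N -> (inord j.-1 : 'I_n.+1) = j.-1 :> nat.
  by move=> H; rewrite inordK //; lia.
have s_uniq : uniq s.
  rewrite /s; case: ifP => H1; case: ifP => H2;
    rewrite /= ?inE !xpair_eqE -!val_eqE /= ?i1 ?i4 ?(jS H1) ?(jP H2); lia.
have s_sub : {subset s <= open_nbh (cycle_box_path 5 n.+1) (i, j)}.
  apply/allP; rewrite /s; case: ifP => H1; case: ifP => H2;
    rewrite /= ?inE /cycle_box_path /cartesian_adj /cycle_adj /path_adj /=
       -!val_eqE /=
       ?i1 ?i4 ?(jS H1) ?(jP H2); lia.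
rewrite (leq_trans (cover _ _ (cls5 (i, j)) Hj)) // fE -!addnA leq_add2l.
apply: leq_trans (leq_sum_seq_set _ _ _ _ s_uniq s_sub).
have e1 : cls (inord ((i + 1) %% 5), j) = ((cls (i, j) + 1) %% 5)%N.
  by rewrite /cls /= i1; lia.
have e4 : cls (inord ((i + 4) %% 5), j) = ((cls (i, j) + 4) %% 5)%N.
  by rewrite /cls /= i4; lia.
rewrite /s !big_cat /= !big_cons big_nil !fE e1 e4 /= addn0 -!addnA !leq_add2l.
apply: leq_add; case: ifP => // H; rewrite big_seq1 fE /cls /=.
  rewrite (jS H); suff -> : ((i + 3 * j.+1) %% 5 = ((i + 3 * j) %% 5 + 3) %% 5)%N by [].
  by lia.
rewrite (jP H); suff -> : ((i + 3 * j.-1) %% 5 = ((i + 3 * j) %% 5 + 2) %% 5)%N by [].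
by lia.
Qed.

(* The last two cases of [L] are the vertices (2n + 1 mod 5, n - 1), (4, 0). *)
Lemma gamma_le_codes (n k : nat) : (2 <= n)%N ->
  (gamma_kR (cycle_box_path 5 n) k <=
     n * (k + 3) + 2 + k %/ 3 + (k + 1) %/ 3)%N.
Proof.
move=> n2; pose L t j := (match t with
  | 0 => (k %/ 3).+1 | 1 => ((k + 2) %/ 3).+1 | 2 => ((k + 1) %/ 3).+1
  | 3 => if j.+1 == n then ((k + 1) %/ 3).+1 else 0
  | _ => if j == 0 then (k %/ 3).+1 else 0 end)%N.
have -> : (n * (k + 3) + 2 + k %/ 3 + (k + 1) %/ 3 =
           \sum_(j < n) \sum_(t < 5) L t j)%N.
  transitivity (\sum_(j < n) (k + 3 + (if j.+1 == n then ((k + 1) %/ 3).+1 else 0)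
     + (if j == 0 :> nat then (k %/ 3).+1 else 0)))%N.
    case: n n2 {L} => [//|n] _; rewrite 2!big_split /= sum_nat_const card_ord.
    have first a : (\sum_(j < n.+1) (if j == 0 :> nat then a else 0) = a)%N.
      by rewrite big_ord_recl big1 //= addn0.
    have last a : (\sum_(j < n.+1) (if j.+1 == n.+1 then a else 0) = a)%N.
      rewrite big_ord_recr /= eqxx big1 // => i _.
      by rewrite eqSS ltn_eqF ?ltn_ord.
    by rewrite first last; lia.
  by apply: eq_bigr => j _; rewrite !big_ord_recr big_ord0 /= /L; lia.
apply: gamma_le_table => [t j _ _|t j].
  by rewrite /L; case: t => [|[|[|[|t]]]]; try case: ifP; lia.
(* At [j = 0] the classes 3, 4, 0 lose neighbours of classes 0, 1, 2, and class 4 compensates. At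
   [j = n - 1] the classes 2, 3, 4 lose neighbours of classes 0, 1, 2, and class 3 compensates. *)
case: t => [|[|[|[|[|t]]]]] // _ Hj; rewrite /L /= ?modn_small //=;
  case: ifP => H1; case: ifP => H2; do ?case: ifP; lia.
Qed.

(* [base] solves k = 5; it was found by simulated annealing, requiring positive
   labels on the support of the labelling in [gamma_le_codes], which therefore
   absorbs each increase of k by 15 at a cost of 70. *)
Lemma gamma_le_path4 (q : nat) :
  (gamma_kR (cycle_box_path 5 4) (15 * q + 5) <= 70 * q + 36)%N.
Proof.
pose base := [:: [:: 3; 3; 1; 0; 3]; [:: 3; 4; 1; 0; 0];
                 [:: 1; 4; 2; 0; 0]; [:: 1; 4; 3; 3; 0]]%N.
pose L t j := let b := nth 0%N (nth [::] base j) t in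
  if b == 0%N then 0%N else (5 * q + b)%N.
(* [base] has 14 positive entries, with sum 36. *)
have -> : (70 * q + 36 = \sum_(j < 4) \sum_(t < 5) L t j)%N.
  by rewrite !big_ord_recr !big_ord0 /= /L /=; lia.
apply: gamma_le_table => t j; case: t => [|[|[|[|[|t]]]]] // _;
  case: j => [|[|[|[|j]]]] // _; rewrite /L /=; lia.
Qed.

(** The four inequalities pin [C] and [D] to the two ceilings, leaving pure integer arithmetic. *)
Lemma weight_bound (n k : nat) (C D : int) :
  (4 <= n)%N -> 5 * C < k%:Z + 10 -> k%:Z + 5 <= 5 * C ->
  3 * D < k%:Z + 6 - C -> k%:Z + 3 - C <= 3 * D ->
  (gamma_kR (cycle_box_path 5 n) k)%:Z <= 5 * (n%:Z - 2) * C + 10 * D - n%:Z.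
Proof.
move=> n4 C1 C2 D1 D2.
case: (boolP ((n == 4) && (k %% 15 == 5)))%N => [/andP[/eqP -> /eqP kq]|not_exc].
  (* With [q = k %/ 15], [C = 3q + 2] and [D = 4q + 2], so the bound is exactly [70q + 36]. *)
  have := gamma_le_path4 (k %/ 15).
  have -> : (15 * (k %/ 15) + 5 = k)%N by lia.
  by lia.
have gle := gamma_le_codes n k (leq_trans (isT : (2 <= 4)%N) n4).
set g := gamma_kR _ _ in gle *.
(* Once this product is made a variable, the goal is linear. *)
have slack : 0 <= (n%:Z - 4) * (5 * C - 5 - k%:Z) by apply: mulr_ge0; lia.
have : (n * (k + 3))%N%:Z = n%:Z * (k%:Z + 3) by rewrite PoszM.
move: (n * (k + 3))%N gle => w gle EwZ.
have -> : 5 * (n%:Z - 2) * C + 10 * D - n%:Z =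
  (n%:Z - 4) * (5 * C - 5 - k%:Z) + w%:Z + n%:Z + 2 * (5 * C - 5 - k%:Z)
   - 2 * k%:Z - 10 + 10 * D by rewrite EwZ; ring.
move: slack; move: ((n%:Z - 4) * _) => z slack; lia.
Qed.

Lemma bound_le (n k : nat) (C D : int) :
  (4 <= n)%N -> 5 * C < k%:Z + 10 -> 3 * D < k%:Z + 6 - C ->
  3 * (5 * (n%:Z - 2) * C + 10 * D - n%:Z)
    <= 3 * n%:Z * k%:Z + 30 * n%:Z + 2 * k%:Z - 10.
Proof.
move=> n4 C1 D1.
(* By integrality [5 * C <= k + 9]; the rest is again linear. *)
have slack : 0 <= (n%:Z - 4) * (k%:Z + 9 - 5 * C) by apply: mulr_ge0; lia.
rewrite -subr_ge0.
have -> : 3 * n%:Z * k%:Z + 30 * n%:Z + 2 * k%:Z - 10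
    - 3 * (5 * (n%:Z - 2) * C + 10 * D - n%:Z) =
  3 * ((n%:Z - 4) * (k%:Z + 9 - 5 * C))
    + (6 * n%:Z + 14 * k%:Z + 98 - 30 * C - 30 * D) by ring.
move: slack; move: ((n%:Z - 4) * _) => z slack; lia.
Qed.

Theorem theorem7 (n k : nat) (hn : (4 <= n)%N) (hk : (1 <= k)%N) :
  let N : rat := n%:R in
  let K : rat := k%:R in
  let c : rat := (Num.ceil ((K + 5) / 5))%:~R in
  let d : rat := (Num.ceil ((K + 3 - c) / 3))%:~R in
  (gamma_kR (cycle_box_path 5 n) k)%:R <= 5 * (N - 2) * c + 10 * d - N
  /\ 5 * (N - 2) * c + 10 * d - N <= (3 * N * K + 30 * N + 2 * K - 10) / 3.
Proof.
move=> N K c d; pose C := Num.ceil ((K + 5) / 5).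
pose D := Num.ceil ((K + 3 - c) / 3).
have ceil_bounds (x : rat) : x <= (Num.ceil x)%:~R < x + 1.
  by have := ceil_itv x; rewrite rmorphB ltrBlDr => /andP[-> ->].
have /andP[c_ge c_lt] : (K + 5) / 5 <= c < (K + 5) / 5 + 1 by [].
have /andP[d_ge d_lt] : (K + 3 - c) / 3 <= d < (K + 3 - c) / 3 + 1 by [].
have EN : N = (n%:Z)%:~R by rewrite -pmulrn.
have EK : K = (k%:Z)%:~R by rewrite -pmulrn.
have c_hi : 5 * C < k%:Z + 10.
  by rewrite -(ltr_int rat) rmorphM rmorphD /= -/c -/K; lra.
have c_lo : k%:Z + 5 <= 5 * C.
  by rewrite -(ler_int rat) rmorphM rmorphD /= -/c -/K; lra.
have d_hi : 3 * D < k%:Z + 6 - C.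
  by rewrite -(ltr_int rat) rmorphM rmorphB rmorphD /= -/c -/d -/K; lra.
have d_lo : k%:Z + 3 - C <= 3 * D.
  by rewrite -(ler_int rat) rmorphM rmorphB rmorphD /= -/c -/d -/K; lra.
have -> : 5 * (N - 2) * c + 10 * d - N =
    (5 * (n%:Z - 2) * C + 10 * D - n%:Z)%:~R :> rat.
  by rewrite EN /c /d -/C -/D; ring.
split; first by rewrite pmulrn ler_int weight_bound.
rewrite ler_pdivlMr // mulrC.
have -> : 3 * N * K + 30 * N + 2 * K - 10 =
    (3 * n%:Z * k%:Z + 30 * n%:Z + 2 * k%:Z - 10)%:~R :> rat.
  by rewrite EN EK; ring.
by have := bound_le _ _ _ _ hn c_hi d_hi; rewrite -(ler_int rat) rmorphM.
Qed.
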